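(* Let $n,\lambda\ge2$ be even integers, $m=1+\frac{\lambda}{2}$, $\sigma>0$, $b_0>0$ and $0<\delta<\frac{b_0}{2(m+1)}$. Let $\rho$, $c_0$, $c_1$ and the function $MN:[c_0,\infty)\to(0,\infty)$ (for the class $E_\sigma$) be as defined in the context. If $1+\lambda-n<0$, then there exist $c^*\in[c_0,c_1]$ minimizing $MN$ on $[c_0,c_1]$ and $c^{**}\in[c_1,\infty)$ minimizing $MN$ on $[c_1,\infty)$, and for any such $c^*,c^{**}$ the optimal choice of $c\in[c_0,\infty)$ is $c^*$ if $MN(c^* )\le MN(c^{**})$, and $c^{**}$ if $MN(c^{**})\le MN(c^* )$.
   Context: The constant $\rho$ is: $\rho=1+\frac{s}{2m+3}$ with $s=\lceil\frac{n-\lambda-3}{2}\rceil$ if $n-\lambda>3$; $\rho=1$ if $n-\lambda\le3$. $c_0:=24\rho(m+1)\delta$, $c_1:=12\rho b_0$. The MN function (for functions in $E_\sigma$, with $b_0$ fixed) is $$MN(c)=\begin{cases}\sqrt{8\rho}\,c^{\frac{\lambda-n-1}{4}}\sup_{\xi\in R^n}\Big\{|\xi|^{\frac{1+n+\lambda}{4}}e^{\frac{c|\xi|}{2}-\frac{|\xi|^2}{2\sigma}}\Big\}\left(\frac23\right)^{\frac{c}{24\rho\delta}} & c_0\le c\le c_1,\\[1ex] \sqrt{\frac{2}{3b_0}}\,c^{\frac{1+\lambda-n}{4}}\sup_{\xi\in R^n}\Big\{|\xi|^{\frac{1+n+\lambda}{4}}e^{\frac{c|\xi|}{2}-\frac{|\xi|^2}{2\sigma}}\Big\}\left(\frac23\right)^{\frac{b_0}{2\delta}}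 & c_1\le c<\infty,\end{cases}$$ where $|\xi|$ is the Euclidean norm. The two formulas agree at $c=c_1$. A value of $c\in[c_0,\infty)$ is called optimal if it minimizes $MN$ over $[c_0,\infty)$. *)

(* Defs.v *)
From mathcomp Require Import all_boot all_order all_algebra.
From mathcomp Require Import all_classical all_reals all_analysis.

Set Implicit Arguments.
Unset Strict Implicit.
Unset Printing Implicit Defensive.

Import Order.TTheory GRing.Theory Num.Theory.

Local Open Scope classical_set_scope.
Local Open Scope ring_scope.

(* The norm `|x| that 'rV[R]_n carries in the library is the sup norm. *)
Definition enorm (R : realType) (n : nat) (x : 'rV[R]_n) : R :=
  Num.sqrt (\sum_(i < n) x 0 i ^+ 2).

Definition rho (R : realType) (n lambda m : nat) : R :=
  if 3 < n%:Z - lambda%:Z then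
    1 + (Num.ceil ((n%:R - lambda%:R - 3) / 2 : R))%:~R / (2 * m%:R + 3)
  else 1.

Definition c0 (R : realType) (n lambda m : nat) (delta : R) : R :=
  24 * rho R n lambda m * (m%:R + 1) * delta.

Definition c1 (R : realType) (n lambda m : nat) (b0 : R) : R :=
  12 * rho R n lambda m * b0.

(* The real supremum [sup] is meant for nonempty bounded-above sets. For
   sigma > 0 the Gaussian factor bounds the set below, which is nonempty. *)
Definition supfactor (R : realType) (n lambda : nat) (sigma c : R) : R :=
  sup [set enorm xi `^ ((1 + n%:R + lambda%:R) / 4)
           * expR (c * enorm xi / 2 - enorm xi ^+ 2 / (2 * sigma))
      | xi in [set: 'rV[R]_n]].

(* Only the values at c >= c0 are meaningful. The two formulas agree at c1. *)
Definition MN (R : realType) (n lambda m : nat) (sigma b0 delta c : R) : R :=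
  if c <= c1 n lambda m b0 then
    Num.sqrt (8 * rho R n lambda m)
    * c `^ ((lambda%:R - n%:R - 1) / 4)
    * supfactor n lambda sigma c
    * (2 / 3) `^ (c / (24 * rho R n lambda m * delta))
  else
    Num.sqrt (2 / (3 * b0))
    * c `^ ((1 + lambda%:R - n%:R) / 4)
    * supfactor n lambda sigma c
    * (2 / 3) `^ (b0 / (2 * delta)).

Definition minimizes_on (R : realType) (f : R -> R) (A : set R) (c : R) : Prop :=
  A c /\ forall x, A x -> f c <= f x.

Definition optimal (R : realType) (n lambda m : nat) (sigma b0 delta c : R) :
    Prop :=
  minimizes_on (MN n lambda m sigma b0 delta)
    `[c0 n lambda m delta, +oo[ c.

(* Main.v *)
(* With r = |xi|, the supremum over xi is that of
   phi(r) = r^a exp(c r / 2 - r^2 / (2 sigma)) over r >= 0, a = (1+n+lambda)/4.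
   As ln phi is strictly concave, the supremum is attained at the positive root
   r_c of r^2 - (sigma c / 2) r - a sigma = 0, and r_c is continuous in c. So
   both branches of MN are continuous, and since they agree at c1, MN attains
   its minimum on [c0, c1] and on every [c1, M]. The test radius
   r = sigma c / 2 bounds the supremum below by (sigma c / 2)^a, so on
   [c1, +oo[ MN dominates a constant times c^((1+lambda)/2), and the
   minimization there reduces to a compact interval. *)
Require Import Defs.
From mathcomp Require Import all_boot all_order all_algebra.
From mathcomp Require Import all_classical all_reals all_analysis.
From mathcomp Require Import ring lra zify.

Import Order.TTheory GRing.Theory Num.Theory.
Import numFieldNormedType.Exports.

Local Open Scope classical_set_scope.
Local Open Scope ring_scope.

(** * Maximum of the radial profile *)

Definition radial_profile (R : realType) (a sigma c r : R) : R :=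
  r `^ a * expR (c * r / 2 - r ^+ 2 / (2 * sigma)).

Definition critical_radius (R : realType) (a sigma c : R) : R :=
  (sigma * c / 2 + Num.sqrt ((sigma * c / 2) ^+ 2 + 4 * a * sigma)) / 2.

Lemma critical_radius_gt0 (R : realType) (a sigma c : R) :
  0 < a -> 0 < sigma -> 0 < critical_radius R a sigma c.
Proof.
move=> a0 s0; rewrite /critical_radius divr_gt0//.
have as0 : 0 < 4 * a * sigma by rewrite !mulr_gt0.
have : `|sigma * c / 2| < Num.sqrt ((sigma * c / 2) ^+ 2 + 4 * a * sigma).
  by rewrite -sqrtr_sqr ltr_sqrt ?ltrDl// ltr_wpDl// sqr_ge0.
by rewrite ltr_norml => /andP[+ _]; lra.
Qed.

Lemma critical_radiusE (R : realType) (a sigma c : R) :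
  0 < a -> 0 < sigma ->
  critical_radius R a sigma c ^+ 2
    = sigma * c / 2 * critical_radius R a sigma c + a * sigma.
Proof.
move=> a0 s0; rewrite /critical_radius; set q := Num.sqrt _.
have : q ^+ 2 = (sigma * c / 2) ^+ 2 + 4 * a * sigma.
  by rewrite sqr_sqrtr// addr_ge0 ?sqr_ge0// !mulr_ge0// ltW.
by move=> q2; rewrite expr_div_n sqrrD q2; field.
Qed.

Lemma ln_le_subr1 (R : realType) (x : R) : 0 < x -> ln x <= x - 1.
Proof. by move=> x0; have := expR_ge1Dx (ln x); rewrite lnK//; lra. Qed.

(** Put s for the critical radius, r = u s and t = s^2 / sigma. The logarithm of the profile at r
    minus that at s is a (ln u - u + 1) - t (u - 1)^2 / 2, and both terms are nonpositive. *)
Lemma radial_profile_max (R : realType) (a sigma c r : R) :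
  0 < a -> 0 < sigma -> 0 <= r ->
  radial_profile R a sigma c r
    <= radial_profile R a sigma c (critical_radius R a sigma c).
Proof.
move=> a0 s0; rewrite /radial_profile le_eqVlt => /predU1P[<-|r0].
  by rewrite powR0 ?gt_eqF// mul0r mulr_ge0 ?powR_ge0 ?expR_ge0.
have := critical_radius_gt0 R a sigma c a0 s0.
have := critical_radiusE R a sigma c a0 s0.
move: (critical_radius _ _ _ _) => s sE sgt0.
rewrite /powR !gt_eqF// -!expRD ler_expR.
have [u u0 ->] : exists2 u, 0 < u & r = u * s.
  by exists (r / s); rewrite ?divr_gt0// divfK ?gt_eqF.
have lnu := ler_wpM2l (ltW a0) (ln_le_subr1 R u u0).
rewrite lnM ?posrE//.
(* The critical equation, solved for c s, eliminates c from both exponents. *)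
have csE : c * s = 2 * (s ^+ 2 / sigma - a).
  by rewrite sE; field; rewrite gt_eqF.
have -> : c * (u * s) = c * s * u by ring.
rewrite csE.
have -> : (u * s) ^+ 2 / (2 * sigma) = s ^+ 2 / sigma * u ^+ 2 / 2.
  by field; rewrite gt_eqF.
have -> : s ^+ 2 / (2 * sigma) = s ^+ 2 / sigma / 2.
  by field; rewrite gt_eqF.
have t0 : 0 <= s ^+ 2 / sigma by rewrite divr_ge0 ?sqr_ge0 ?ltW.
have := mulr_ge0 t0 (sqr_ge0 (1 - u)).
move: (s ^+ 2 / sigma) => t.
rewrite mulrDr; nra.
Qed.

(** * The supremum over vectors as a radial maximum *)

Lemma enorm_ge0 (R : realType) (n : nat) (x : 'rV[R]_n) : 0 <= enorm x.
Proof. exact: sqrtr_ge0. Qed.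

(** Lets every radius r >= 0 compete in the supremum over vectors. *)
Lemma enorm_surj (R : realType) (n : nat) (r : R) :
  (0 < n)%N -> 0 <= r -> exists x : 'rV[R]_n, enorm x = r.
Proof.
case: n => // n _ r0; exists (\row_j (if j == ord0 then r else 0)).
rewrite /enorm big_ord_recl !mxE/= big1 ?addr0 ?sqrtr_sqr ?ger0_norm// => i _.
by rewrite mxE/= expr0n.
Qed.

Lemma exponent_gt0 (R : realType) (n lambda : nat) :
  0 < (1 + n%:R + lambda%:R) / 4 :> R.
Proof. by rewrite divr_gt0// ltr_pwDl// ltr_pwDl. Qed.

(** The value at the critical radius bounds the set above, so [sup] is a genuine upper bound. *)
Lemma radial_profile_le_supfactor (R : realType) (n lambda : nat)
    (sigma c r : R) :
  (0 < n)%N -> 0 < sigma -> 0 <= r ->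
  radial_profile R ((1 + n%:R + lambda%:R) / 4) sigma c r
    <= supfactor n lambda sigma c.
Proof.
move=> n0 s0 r0; apply: ub_le_sup.
  exists (radial_profile R ((1 + n%:R + lambda%:R) / 4) sigma c
    (critical_radius R ((1 + n%:R + lambda%:R) / 4) sigma c)).
  move=> _ [xi _ <-].
  exact: radial_profile_max (exponent_gt0 _ _ _) s0 (enorm_ge0 _ _ _).
by have [xi <-] := enorm_surj R n r n0 r0; exists xi.
Qed.

Lemma supfactorE (R : realType) (n lambda : nat) (sigma c : R) :
  (0 < n)%N -> 0 < sigma ->
  supfactor n lambda sigma c =
  radial_profile R ((1 + n%:R + lambda%:R) / 4) sigma c
    (critical_radius R ((1 + n%:R + lambda%:R) / 4) sigma c).
Proof.
move=> n0 s0; apply/eqP; rewrite eq_le; apply/andP; split; last first.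
  apply: radial_profile_le_supfactor => //.
  exact/ltW/critical_radius_gt0/s0/exponent_gt0.
apply: ge_sup; first by eexists; exists 0.
move=> _ [xi _ <-].
exact: radial_profile_max (exponent_gt0 _ _ _) s0 (enorm_ge0 _ _ _).
Qed.

(** * Continuity of the two branches *)

Lemma continuous_powR (R : realType) (p x : R) :
  0 < x -> {for x, continuous (fun c : R => c `^ p)}.
Proof.
move=> x0; apply/differentiable_continuous/derivable1_diffP.
by apply: derivable_powR; rewrite in_itv/= x0.
Qed.

Lemma continuous_critical_radius (R : realType) (a sigma : R) :
  continuous (critical_radius R a sigma).
Proof.
move=> x; rewrite /critical_radius.
have h : {for x, continuous (fun c : R => sigma * c / 2)}.
  by apply: cvgM; [apply: cvgM; [exact: cvg_cst|exact: cvg_id]|exact: cvg_cst].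
apply: cvgM; last exact: cvg_cst.
apply: cvgD; first exact: h.
apply: continuous_cvg; first exact: sqrt_continuous.
by apply: cvgD; [exact: cvgM|exact: cvg_cst].
Qed.

Lemma continuous_supfactor (R : realType) (n lambda : nat) (sigma : R) :
  (0 < n)%N -> 0 < sigma -> continuous (supfactor n lambda sigma).
Proof.
move=> n0 s0.
rewrite (funext (fun c => supfactorE R n lambda sigma c n0 s0)).
move=> x; rewrite /radial_profile.
have a0 := exponent_gt0 R n lambda.
move: ((1 + n%:R + lambda%:R) / 4) a0 => a a0.
have h := continuous_critical_radius R a sigma x.
apply: cvgM.
  apply: (@continuous_cvg _ _ _ _ _ _ (fun r => r `^ a)) => //.
  by apply: continuous_powR; exact: critical_radius_gt0.
apply: continuous_cvg; first exact: continuous_expR.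
apply: cvgB; first by apply: cvgM; [apply: cvgM => //; exact: cvg_id|exact: cvg_cst].
by apply: cvgM; [exact: cvgM|exact: cvg_cst].
Qed.

(** Each formula is kept apart from the case split, so that two-sided continuity is available at
    [c1], where [MN] changes formula. *)
Definition MN_left (R : realType) (n lambda m : nat) (sigma delta c : R) : R :=
  Num.sqrt (8 * rho R n lambda m)
  * c `^ ((lambda%:R - n%:R - 1) / 4)
  * supfactor n lambda sigma c
  * (2 / 3) `^ (c / (24 * rho R n lambda m * delta)).

Definition MN_right (R : realType) (n lambda : nat) (sigma b0 delta c : R) : R :=
  Num.sqrt (2 / (3 * b0))
  * c `^ ((1 + lambda%:R - n%:R) / 4)
  * supfactor n lambda sigma c
  * (2 / 3) `^ (b0 / (2 * delta)).

Lemma continuous_MN_left (R : realType) (n lambda m : nat) (sigma delta x : R) :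
  (0 < n)%N -> 0 < sigma -> 0 < x ->
  {for x, continuous (MN_left R n lambda m sigma delta)}.
Proof.
move=> n0 s0 x0; rewrite /MN_left.
apply: cvgM.
  apply: cvgM; last exact: continuous_supfactor.
  by apply: cvgM; [exact: cvg_cst|exact: continuous_powR].
(* Here c is in the exponent and the base is fixed, so the power is opened as an exponential. *)
rewrite /powR gt_eqF//.
apply: continuous_cvg; first exact: continuous_expR.
apply: cvgM; last exact: cvg_cst.
by apply: cvgM; [exact: cvg_id|exact: cvg_cst].
Qed.

Lemma continuous_MN_right (R : realType) (n lambda : nat)
    (sigma b0 delta x : R) :
  (0 < n)%N -> 0 < sigma -> 0 < x ->
  {for x, continuous (MN_right R n lambda sigma b0 delta)}.
Proof.
move=> n0 s0 x0; rewrite /MN_right.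
apply: cvgM; last exact: cvg_cst.
apply: cvgM; last exact: continuous_supfactor.
by apply: cvgM; [exact: cvg_cst|exact: continuous_powR].
Qed.

(** * Agreement of [MN] with its branches *)

Lemma rho_gt0 (R : realType) (n lambda m : nat) : 0 < rho R n lambda m.
Proof.
rewrite /rho; case: ifPn => // h.
have {}h : 3 < n%:R - lambda%:R :> R by rewrite ltrBrDr -natrD ltr_nat; lia.
rewrite ltr_pwDl// divr_ge0 ?addr_ge0 ?mulr_ge0// ler0z ceil_ge0.
lra.
Qed.

Lemma MN_leftE (R : realType) (n lambda m : nat) (sigma b0 delta c : R) :
  c <= c1 n lambda m b0 ->
  MN n lambda m sigma b0 delta c = MN_left R n lambda m sigma delta c.
Proof. by rewrite /MN => ->. Qed.

Lemma MN_rightE (R : realType) (n lambda m : nat) (sigma b0 delta c : R) :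
  0 < b0 -> 0 < delta -> c1 n lambda m b0 <= c ->
  MN n lambda m sigma b0 delta c = MN_right R n lambda sigma b0 delta c.
Proof.
move=> b00 d0; rewrite le_eqVlt /MN => /predU1P[<-|]; last by rewrite ltNge => /negbTE ->.
rewrite lexx /MN_right.
have r0 := rho_gt0 R n lambda m.
have c10 : 0 < c1 n lambda m b0 by rewrite !mulr_gt0.
have -> : c1 n lambda m b0 / (24 * rho R n lambda m * delta) = b0 / (2 * delta).
  by rewrite /c1; field; rewrite !gt_eqF.
congr (_ * _ * _).
(* The powers of [c1] differ by its square root, and 2 / (3 b0) * 12 rho b0 = 8 rho reconciles the
   constants. *)
have -> : (1 + lambda%:R - n%:R) / 4 = 2^-1 + (lambda%:R - n%:R - 1) / 4 :> R.
  by field.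
rewrite [in RHS]powRD; last by apply/implyP => _; rewrite gt_eqF.
rewrite mulrA; congr (_ * _).
rewrite powR12_sqrt ?ltW// -sqrtrM ?divr_ge0 ?mulr_ge0// ?ltW//.
by congr Num.sqrt; rewrite /c1; field; rewrite gt_eqF.
Qed.

(** * Growth of the unbounded branch *)

Lemma supfactor_lower_bound (R : realType) (n lambda : nat) (sigma c : R) :
  (0 < n)%N -> 0 < sigma -> 0 <= c ->
  (sigma * c / 2) `^ ((1 + n%:R + lambda%:R) / 4) <= supfactor n lambda sigma c.
Proof.
move=> n0 s0 c0.
have r0 : 0 <= sigma * c / 2 by rewrite divr_ge0 ?mulr_ge0// ltW.
apply: le_trans (radial_profile_le_supfactor R n lambda sigma c _ n0 s0 r0).
rewrite /radial_profile ler_peMr ?powR_ge0// -[leLHS]expR0 ler_expR.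
(* At the test radius the exponent is nonnegative, so the exponential is at least 1. *)
have -> : c * (sigma * c / 2) / 2 - (sigma * c / 2) ^+ 2 / (2 * sigma)
    = sigma * c ^+ 2 / 8 by field; rewrite gt_eqF.
by rewrite divr_ge0 ?mulr_ge0 ?sqr_ge0 ?ler0n ?(ltW s0).
Qed.

(** The exponents of c add up to (1 + lambda) / 2: n cancels, and the sum is at least 1 because
    lambda >= 1. For c >= 1 that power is at least c. *)
Lemma MN_right_ge_linear (R : realType) (n lambda : nat) (sigma b0 delta : R) :
  (0 < n)%N -> (0 < lambda)%N -> 0 < sigma -> 0 < b0 ->
  exists2 k : R, 0 < k &
    forall c, 1 <= c -> k * c <= MN_right R n lambda sigma b0 delta c.
Proof.
move=> n0 l0 s0 b00.
set a := (1 + n%:R + lambda%:R) / 4 : R.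
exists (Num.sqrt (2 / (3 * b0)) * (sigma / 2) `^ a * (2 / 3) `^ (b0 / (2 * delta))).
  by rewrite !mulr_gt0 ?powR_gt0 ?sqrtr_gt0 ?divr_gt0 ?mulr_gt0.
move=> c c_ge1; have cgt0 : 0 < c by apply: lt_le_trans c_ge1.
rewrite /MN_right mulrAC ler_wpM2r ?powR_ge0// -!mulrA ler_wpM2l ?sqrtr_ge0//.
apply: (@le_trans _ _ (c `^ ((1 + lambda%:R - n%:R) / 4) * (sigma * c / 2) `^ a)); last first.
  by rewrite ler_wpM2l ?powR_ge0// supfactor_lower_bound// ltW.
have -> : sigma * c / 2 = sigma / 2 * c by field.
rewrite [(_ * c) `^ a]powRM ?divr_ge0 ?ler0n ?(ltW s0) ?(ltW cgt0)// mulrCA ler_wpM2l ?powR_ge0//.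
rewrite -powRD; last by apply/implyP => _; rewrite gt_eqF.
apply: le1r_powR => //.
have : 1 <= lambda%:R :> R by rewrite ler1n.
rewrite /a; lra.
Qed.

(** * Existence and gluing of minimizers *)

(** Continuity is asked of a function g that agrees with f on the interval, since f itself may
    follow another formula beyond an endpoint. *)
Lemma EVT_min_in (R : realType) (f g : R -> R) (a b : R) :
  a <= b -> {in `[a, b], f =1 g} ->
  (forall x, a <= x -> {for x, continuous g}) ->
  exists c, minimizes_on f [set` `[a, b]] c.
Proof.
move=> ab fg gc.
have [|c cab cmin] := @EVT_min R g a b ab.
  apply: continuous_in_subspaceT => x /set_mem/=.
  by rewrite in_itv/= => /andP[ax _]; exact: gc.
by exists c; split=> // x xab; rewrite !fg//; exact: cmin.
Qed.

Lemma minimizer_exists_itvcy (R : realType) (f g : R -> R) (a k : R) :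
  {in `[a, +oo[, f =1 g} ->
  (forall x, a <= x -> {for x, continuous g}) ->
  0 < k -> (forall x, 1 <= x -> k * x <= g x) ->
  exists c, minimizes_on f [set` `[a, +oo[] c.
Proof.
move=> fg gc k0 gk.
(* Past M the linear bound applies, as x > 1, and gives g x >= k x > g a. Taking M >= a puts a
   itself in the compact interval. *)
pose M := Num.max a (Num.max 1 (g a / k)).
have aM : a <= M by rewrite le_max lexx.
have [|c [cab cmin]] := EVT_min_in R f g a M aM _ gc.
  by move=> x /[!in_itv]/= /andP[ax _]; apply: fg; rewrite in_itv/= ax.
exists c; split; first by move: cab; rewrite /= !in_itv/= => /andP[->].
move=> x /=; rewrite in_itv/= andbT => ax.
have [xM|Mx] := leP x M; first by apply: cmin; rewrite /= in_itv/= ax.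
apply: (@le_trans _ _ (f a)); first by apply: cmin; rewrite /= in_itv/= lexx.
rewrite !fg ?in_itv/= ?lexx ?ax//.
move: Mx; rewrite !gt_max => /and3P[_ x1 gx].
by rewrite (le_trans _ (gk x (ltW x1)))// mulrC -ler_pdivrMr// ltW.
Qed.

(** Every x >= a lies in one of the two intervals, so one of the two minima bounds f x below, and
    hence the smaller one does. *)
Lemma minimizes_on_itv_glue (R : realType) (f : R -> R) (a b cs css : R) :
  a <= b -> minimizes_on f [set` `[a, b]] cs ->
  minimizes_on f [set` `[b, +oo[] css ->
  (f cs <= f css -> minimizes_on f [set` `[a, +oo[] cs) /\
  (f css <= f cs -> minimizes_on f [set` `[a, +oo[] css).
Proof.
move=> ab [+ csmin] [+ cssmin]; rewrite /= !in_itv/= !andbT => /andP[acs _] bcss.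
have fmin x : a <= x -> f cs <= f x \/ f css <= f x.
  move=> ax; have [xb|/ltW bx] := leP x b.
    by left; apply: csmin; rewrite /= in_itv/= ax.
  by right; apply: cssmin; rewrite /= in_itv/= bx.
split=> le_f; split; rewrite /= ?in_itv/= ?andbT//.
- by move=> x; rewrite in_itv/= andbT => /fmin[//|]; exact: le_trans.
- exact: le_trans bcss.
- by move=> x; rewrite in_itv/= andbT => /fmin[|//]; exact: le_trans.
Qed.

Theorem mainTheorem8 (R : realType) (n lambda m : nat) (sigma b0 delta : R)
    (hn2 : (2 <= n)%N) (hn : ~~ odd n)
    (hl2 : (2 <= lambda)%N) (hl : ~~ odd lambda)
    (hm : m = (1 + lambda %/ 2)%N)
    (hsigma : 0 < sigma) (hb0 : 0 < b0)
    (hdelta0 : 0 < delta) (hdelta : delta < b0 / (2 * (m%:R + 1)))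
    (hneg : 1 + lambda%:Z - n%:Z < 0) :
  let f := MN n lambda m sigma b0 delta in
  let A := `[c0 n lambda m delta, c1 n lambda m b0] in
  let B := `[c1 n lambda m b0, +oo[ in
  [/\ exists cs : R, minimizes_on f [set` A] cs,
      exists css : R, minimizes_on f [set` B] css
    & forall cs css : R,
        minimizes_on f [set` A] cs -> minimizes_on f [set` B] css ->
        (f cs <= f css -> optimal n lambda m sigma b0 delta cs) /\
        (f css <= f cs -> optimal n lambda m sigma b0 delta css)].
Proof.
move=> f A B.
have n0 : (0 < n)%N by exact: ltnW.
have rho0 := rho_gt0 R n lambda m.
have m0 : 0 < m%:R + 1 :> R by rewrite ltr_wpDl.
(* Positivity of [c0] keeps both intervals inside c > 0, where the powers of c are continuous. *)
have c0_gt0 : 0 < c0 n lambda m delta by rewrite !mulr_gt0.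
have c01 : c0 n lambda m delta <= c1 n lambda m b0.
  (* The bound on [delta], multiplied by 12 rho, compares [c0] with [c1]. *)
  move: hdelta; rewrite ltr_pdivlMr ?mulr_gt0// => /ltW hd.
  have -> : c0 n lambda m delta
      = 12 * rho R n lambda m * (delta * (2 * (m%:R + 1))).
    by rewrite /c0; ring.
  by rewrite ler_wpM2l// mulr_ge0// ltW.
split.
- apply: (EVT_min_in R f (MN_left R n lambda m sigma delta)) => //.
    by move=> x; rewrite in_itv/= => /andP[_ xc1]; exact: MN_leftE.
  by move=> x cx; apply: continuous_MN_left => //; exact: lt_le_trans cx.
- have [k k0 gk] :=
    MN_right_ge_linear R n lambda sigma b0 delta n0 (ltnW hl2) hsigma hb0.
  apply: (minimizer_exists_itvcy R f _ _ k _ _ k0 gk).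
    by move=> x; rewrite in_itv/= andbT => c1x; exact: MN_rightE.
  move=> x c1x; apply: continuous_MN_right => //.
  exact: lt_le_trans (le_trans c01 c1x).
- by move=> cs css; exact: minimizes_on_itv_glue.
Qed.
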